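(* (Soundness of LP-TM.) Let $\Phi$ be a logic program and $A$ an atomic formula. If $\Phi\vdash\{A\}\to^*\emptyset$, then there exists a proof term $e$ with $e:\forall\underline{x}.\ \Rightarrow A$ derivable given axioms $\Phi$.
   Context: First-order terms; atomic formulas $P(t_1,\dots,t_n)$; Horn formulas $[\forall \underline{x}].\ A_1,\dots,A_n \Rightarrow A$ ($n\ge0$; for $n=0$ written $\Rightarrow A$), $\forall\underline{x}$ quantifying all free term variables. Proof terms $p,e ::= \kappa \mid a \mid \lambda a.e \mid e\ e'$. A logic program $\Phi$ is a list of closed Horn formulas labelled by distinct proof-term constants. Typing given $\Phi$: (axiom) $\kappa:\forall\underline{x}.F$ if $(\kappa:\forall\underline{x}.F)\in\Phi$; (gen) $e:F\Rightarrow e:\forall\underline{x}.F$; (inst) $e:\forall\underline{x}.F\Rightarrow e:[\underline{t}/\underline{x}]F$; (cut) from $e_1:\underline{A}\Rightarrow D$ and $e_2:\underline{B},D\Rightarrow C$ infer $\lambda\underline{a}.\lambda\underline{b}.(e_2\ \underline{b})(e_1\ \underline{a}):\underline{A},\underline{B}\Rightarrow C$ with fresh proof-variable lists $\underline{a},\underline{b}$. Term-matching (LP-TM) reduction on multisets of atomic formulas: $\Phi\vdash\{A_1,\dots,A_i,\dots,A_n\}\to\{A_1,\dots,\sigma B_1,\dots,\sigma B_m,\dots,A_n\}$ whenever $\kappa:\forall\underline{x}.B_1,\dots,B_m\Rightarrow C\in\Phi$ (variables renamed apart) and $\sigma$ is a matcher with $\sigma C\equiv A_i$. $\to^*$ is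 the reflexive–transitive closure. *)

(* Defs.v *)
From Stdlib Require Import List Permutation Relations.
From Stdlib Require Vector.
Export ListNotations.

Set Implicit Arguments.

Record signature := Signature {
  fsym : Type;
  farity : fsym -> nat;
  psym : Type;
  parity : psym -> nat
}.

Definition var := nat.

Inductive term (S : signature) : Type :=
| Var (x : var)
| App (f : fsym S) (ts : Vector.t (term S) (farity S f)).

Arguments Var {S} x.

Inductive atom (S : signature) : Type :=
| Atom (P : psym S) (ts : Vector.t (term S) (parity S P)).

(* A_1, ..., A_n => A without quantifiers; the premises are an ordered list,
   since proof terms are applied to their arguments in that order. *)
Record clause (S : signature) := Clause {
  premises : list (atom S);
  conclusion : atom S
}.

(* A Horn formula is a clause whose term variables are either all free or all
   universally quantified, so the binder list is determined by the clause. *)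
Inductive horn (S : signature) : Type :=
| HFree (c : clause S)
| HForall (c : clause S).

Inductive occurs_term (S : signature) (x : var) : term S -> Prop :=
| occurs_Var : occurs_term x (Var x)
| occurs_App (f : fsym S) (ts : Vector.t (term S) (farity S f)) (t : term S) :
    Vector.In t ts -> occurs_term x t -> occurs_term x (App f ts).

Definition occurs_atom (S : signature) (x : var) (A : atom S) : Prop :=
  match A with Atom P ts => exists t, Vector.In t ts /\ occurs_term x t end.

Definition occurs_atoms (S : signature) (x : var) (G : list (atom S)) : Prop :=
  exists A, In A G /\ occurs_atom x A.

Definition occurs_clause (S : signature) (x : var) (c : clause S) : Prop :=
  occurs_atoms x (premises c) \/ occurs_atom x (conclusion c).

Definition subst (S : signature) := var -> term S.

Fixpoint subst_term (S : signature) (s : subst S) (t : term S) : term S :=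
  match t with
  | Var x => s x
  | App f ts => App f (Vector.map (subst_term s) ts)
  end.

Definition subst_atom (S : signature) (s : subst S) (A : atom S) : atom S :=
  match A with Atom P ts => Atom P (Vector.map (subst_term s) ts) end.

Definition subst_clause (S : signature) (s : subst S) (c : clause S) : clause S :=
  Clause (map (subst_atom s) (premises c)) (subst_atom s (conclusion c)).

Definition rename_clause (S : signature) (r : var -> var) (c : clause S)
    : clause S :=
  subst_clause (fun x => Var (r x)) c.

(* r renames the variables of c injectively, and apart from those of G. *)
Definition renames_apart (S : signature) (r : var -> var) (c : clause S)
    (G : list (atom S)) : Prop :=
  (forall x y, occurs_clause x c -> occurs_clause y c -> r x = r y -> x = y) /\
  (forall x, occurs_clause x c -> ~ occurs_atoms (r x) G).

Definition pvar := nat.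

Inductive proof_term (K : Type) : Type :=
| PConst (k : K)
| PVar (a : pvar)
| PLam (a : pvar) (e : proof_term K)
| PApp (e1 e2 : proof_term K).

Arguments PVar {K} a.

Fixpoint pvar_occurs (K : Type) (a : pvar) (e : proof_term K) : Prop :=
  match e with
  | PConst _ => False
  | PVar b => a = b
  | PLam b e1 => a = b \/ pvar_occurs a e1
  | PApp e1 e2 => pvar_occurs a e1 \/ pvar_occurs a e2
  end.

Definition plams (K : Type) (a : list pvar) (e : proof_term K) : proof_term K :=
  fold_right (@PLam K) e a.

Definition papps (K : Type) (e : proof_term K) (a : list pvar) : proof_term K :=
  fold_left (fun e' x => PApp e' (PVar x)) a e.

(* An entry (k, c) stands for the closed formula k : forall x. c. *)
Record program (S : signature) (K : Type) := Program {
  axioms : list (K * clause S);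
  axioms_distinct : NoDup (map fst axioms)
}.

Definition fresh_pvars (K : Type) (a : list pvar) (e : proof_term K) : Prop :=
  forall x, In x a -> ~ pvar_occurs x e.

Inductive typing (S : signature) (K : Type) (Phi : program S K)
    : proof_term K -> horn S -> Prop :=
| typing_axiom k c :
    In (k, c) (axioms Phi) -> typing Phi (PConst k) (HForall c)
| typing_gen e c :
    typing Phi e (HFree c) -> typing Phi e (HForall c)
| typing_inst e c (s : subst S) :
    typing Phi e (HForall c) -> typing Phi e (HFree (subst_clause s c))
| typing_cut e1 e2 As Bs D C a b :
    typing Phi e1 (HFree (Clause As D)) ->
    typing Phi e2 (HFree (Clause (Bs ++ [D]) C)) ->
    length a = length As ->
    length b = length Bs ->
    NoDup (a ++ b) ->
    fresh_pvars (a ++ b) e1 ->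
    fresh_pvars (a ++ b) e2 ->
    typing Phi (plams a (plams b (PApp (papps e2 b) (papps e1 a))))
      (HFree (Clause (As ++ Bs) C)).

(* Multisets of atoms are lists up to Permutation. The matcher s is any
   substitution with s C = A; in particular its values on the variables of c
   that do not occur in the conclusion are unconstrained. *)
Definition lp_tm_step (S : signature) (K : Type) (Phi : program S K)
    (G G' : list (atom S)) : Prop :=
  exists (k : K) (c : clause S) (r : var -> var) (s : subst S)
         (A : atom S) (rest : list (atom S)),
    In (k, c) (axioms Phi) /\
    renames_apart r c G /\
    subst_atom s (conclusion (rename_clause r c)) = A /\
    Permutation G (A :: rest) /\
    Permutation G' (map (subst_atom s) (premises (rename_clause r c)) ++ rest).

Definition lp_tm_steps (S : signature) (K : Type) (Phi : program S K)
    : list (atom S) -> list (atom S) -> Prop :=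
  clos_refl_trans (list (atom S)) (lp_tm_step Phi).

(* Main.v *)
Require Import Defs.
From Stdlib Require Import List Permutation Lia.

(** Read backwards, a reduction preserves derivability of all atoms in the
    multiset: the instance [s B1, ..., s Bm => s C] of an axiom is obtained
    by (inst), and its premises are discharged one at a time, from the right,
    by (cut) with [As = []]. *)

(** The unquantified form is the one that (cut) accepts; (gen) restores the quantifier at the very
    end. *)
Definition derivable (S : signature) (K : Type) (Phi : program S K)
    (c : clause S) : Prop :=
  exists e, typing Phi e (HFree c).

Arguments derivable {S K}.

Lemma pvar_occurs_bounded (K : Type) (e : proof_term K) :
  exists n, forall x, pvar_occurs x e -> x < n.
Proof.
  induction e as [k | a | a e [n IH] | e1 [n1 IH1] e2 [n2 IH2]]; simpl.
  - exists 0. tauto.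
  - exists (S a). intros x ->. lia.
  - exists (S a + n). intros x [-> | H]; [lia |]. apply IH in H. lia.
  - exists (n1 + n2). intros x [H | H]; [apply IH1 in H | apply IH2 in H]; lia.
Qed.

Lemma fresh_pvars_exist (K : Type) (e1 e2 : proof_term K) (m : nat) :
  exists b, length b = m /\ NoDup b /\ fresh_pvars b e1 /\ fresh_pvars b e2.
Proof.
  destruct (pvar_occurs_bounded _ e1) as [n1 H1].
  destruct (pvar_occurs_bounded _ e2) as [n2 H2].
  (* Numbers from the sum of both bounds on occur in neither term. *)
  exists (seq (n1 + n2) m).
  repeat split.
  - apply length_seq.
  - apply seq_NoDup.
  - intros x Hx H. apply in_seq in Hx. apply H1 in H. lia.
  - intros x Hx H. apply in_seq in Hx. apply H2 in H. lia.
Qed.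

Lemma derivable_cut_last (S : signature) (K : Type) (Phi : program S K)
    (Bs : list (atom S)) (D C : atom S) :
  derivable Phi (Clause [] D) -> derivable Phi (Clause (Bs ++ [D]) C) ->
  derivable Phi (Clause Bs C).
Proof.
  intros [e1 H1] [e2 H2].
  destruct (fresh_pvars_exist _ e1 e2 (length Bs)) as (b & Hb & Hd & F1 & F2).
  eexists.
  (* With [a] and [As] empty, [a ++ b] and [As ++ Bs] compute to [b] and [Bs]. *)
  exact (typing_cut Bs [] b H1 H2 eq_refl Hb Hd F1 F2).
Qed.

Lemma derivable_discharge (S : signature) (K : Type) (Phi : program S K)
    (Bs : list (atom S)) (C : atom S) :
  (forall B, In B Bs -> derivable Phi (Clause [] B)) ->
  derivable Phi (Clause Bs C) -> derivable Phi (Clause [] C).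
Proof.
  (* Induction from the right end, as (cut) removes the last premise. *)
  induction Bs as [| D Bs IH] using rev_ind; intros HBs HC; [exact HC |].
  apply IH.
  - intros B HB. apply HBs, in_or_app. now left.
  - apply derivable_cut_last with D; [| exact HC].
    apply HBs, in_or_app. right. now left.
Qed.

(* Renaming and matching are two successive (inst) steps separated by a (gen),
   so the composition of substitutions is never needed. *)
Lemma derivable_axiom_instance (S : signature) (K : Type) (Phi : program S K)
    (k : K) (c : clause S) (r : var -> var) (s : subst S) :
  In (k, c) (axioms Phi) ->
  derivable Phi (subst_clause s (rename_clause r c)).
Proof.
  intros Hk. exists (PConst k).
  apply typing_inst, typing_gen, typing_inst, typing_axiom, Hk.
Qed.

(** The rewritten atom is the conclusion of an axiom instance whose premises lie in [G']; every
    other atom of [G] survives in [G']. *)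
Lemma lp_tm_step_derivable (S : signature) (K : Type) (Phi : program S K)
    (G G' : list (atom S)) :
  lp_tm_step Phi G G' ->
  (forall B, In B G' -> derivable Phi (Clause [] B)) ->
  forall B, In B G -> derivable Phi (Clause [] B).
Proof.
  intros (k & c & r & s & A & rest & Hk & _ & <- & HG & HG') H B HB.
  apply (Permutation_in _ HG) in HB as [<- | HB].
  - apply derivable_discharge
      with (map (subst_atom s) (premises (rename_clause r c))).
    + intros B HB. apply H, (Permutation_in _ (Permutation_sym HG')).
      apply in_or_app. now left.
    + exact (derivable_axiom_instance _ _ Phi k c r s Hk).
  - apply H, (Permutation_in _ (Permutation_sym HG')).
    apply in_or_app. now right.
Qed.

(** The implication from [G'] to [G] is reflexive and composes, so it passes to the closure. *)
Lemma lp_tm_steps_derivable (S : signature) (K : Type) (Phi : program S K)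
    (G G' : list (atom S)) :
  lp_tm_steps Phi G G' ->
  (forall B, In B G' -> derivable Phi (Clause [] B)) ->
  forall B, In B G -> derivable Phi (Clause [] B).
Proof.
  induction 1 as [G G' H | G | G1 G2 G3 _ IH1 _ IH2].
  - now apply lp_tm_step_derivable.
  - auto.
  - auto.
Qed.

Theorem theorem8 (S : signature) (K : Type) (Phi : program S K) (A : atom S) :
  lp_tm_steps Phi [A] [] ->
  exists e : proof_term K, typing Phi e (HForall (Clause [] A)).
Proof.
  intros H.
  destruct (lp_tm_steps_derivable _ _ _ _ _ H) with A as [e He].
  (* The empty multiset satisfies the hypothesis vacuously. *)
  - intros B [].
  - now left.
  - exists e. now apply typing_gen.
Qed.
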